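(* For every integer $d>2$ one has $A_{d}\leq A_{d+1}$. In particular, the sequence $(A_{d+2})_{d\geq 1}$ is sub-Fibonacci.
   Context: Binomial expansion: for positive integers $a,t$, there is a unique writing $a=\binom{k(t)}{t}+\binom{k(t-1)}{t-1}+\dots+\binom{k(j)}{j}$ with $k(t)>k(t-1)>\dots>k(j)\geq j\geq 1$; set $a^{\langle t\rangle}:=\binom{k(t)+1}{t+1}+\binom{k(t-1)+1}{t}+\dots+\binom{k(j)+1}{j+1}$, and $0^{\langle t\rangle}:=0$. An $O$-sequence is a sequence $h=(h_0,h_1,h_2,\dots)$ of non-negative integers with $h_0=1$ and $h_{t+1}\leq h_t^{\langle t\rangle}$ for every $t\geq 1$ (equivalently, the Hilbert function of a standard graded algebra over a field). It is finite if it has only finitely many non-zero values; it is then written $h=(h_0,\dots,h_s)$, where $s=\max\{t: h_t\neq 0\}$ is its socle degree, and its multiplicity is $d=\sum_{t=0}^s h_t$. For every positive integer $d$, $A_d$ denotes the number of finite $O$-sequences $(h_0,\dots,h_s)$ of multiplicity $d$ whose last non-zero value satisfies $h_s\geq 2$. A non-decreasing integer sequence $(x_k)_{k\geq 1}$ with $x_1=x_2=1$ is called sub-Fibonacci if $x_k\leq x_{k-1}+x_{k-2}$ for all $k\geq 3$. (Here the sequence is $x_k=A_{k+2}$, $k\ge 1$.) *)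

(* Defs.v *)
From mathcomp Require Import all_boot finmap zify.
From mathcomp Require Import boolp classical_sets functions cardinality.

Set Implicit Arguments.
Unset Strict Implicit.
Unset Printing Implicit Defensive.

Local Open Scope nat_scope.
Local Open Scope classical_set_scope.

(* The list ks = [:: k(t); k(t-1); ...; k(j)] is a t-binomial expansion of a.
   Its entry of rank i is k(t-i), so that j = t - (size ks).-1; the condition
   j >= 1 reads size ks <= t. *)
Definition is_binexp (t a : nat) (ks : seq nat) : bool :=
  [&& 0 < size ks <= t,
      sorted (fun m n => n < m) ks,
      t - (size ks).-1 <= last 0 ks &
      a == \sum_(i < size ks) 'C(nth 0 ks i, t - i)].

Lemma is_binexp1 t a k :
  is_binexp t.+1 a [:: k] = (t < k) && (a == 'C(k, t.+1)).
Proof. by rewrite /is_binexp /= big_ord1 /= !subn0. Qed.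

Lemma is_binexp_cons t a k k' l :
  is_binexp t.+1 a [:: k, k' & l] =
  [&& k' < k, 'C(k, t.+1) <= a & is_binexp t (a - 'C(k, t.+1)) (k' :: l)].
Proof.
rewrite /is_binexp /= big_ord_recl /= subn0 subSS ltnS.
under eq_bigr => i _ do rewrite subSS.
set S := \sum_(i < _) _.
have -> : (a == 'C(k, t.+1) + S) =
          ('C(k, t.+1) <= a) && (a - 'C(k, t.+1) == S) by lia.
by case: (k' < k); case: (_ <= a); rewrite ?andbF.
Qed.

Lemma is_binexp_bounds t a k l : is_binexp t a (k :: l) ->
  [/\ t <= k, 0 < 'C(k, t), 'C(k, t) <= a & a < 'C(k.+1, t)].
Proof.
elim: l t a k => [|k' l IH] [|t] a k.
- by rewrite /is_binexp.
- rewrite is_binexp1 => /andP[ltk /eqP->]; rewrite bin_gt0 ltk leqnn binS.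
  by split=> //; rewrite -addn1 leq_add2l bin_gt0 ltnW.
- by rewrite /is_binexp.
rewrite is_binexp_cons => /and3P[ltk lea /IH[letk' _ _ lta]].
have ltk0 : t < k by apply: leq_ltn_trans ltk.
rewrite bin_gt0 ltk0 lea; split=> //; rewrite binS.
by have := leq_bin2l t ltk; lia.
Qed.

Lemma ex_binexp t a : exists ks, (0 < t) && (0 < a) ==> is_binexp t a ks.
Proof.
elim: t a => [|t IH] a; first by exists [::].
have [->|a_gt0] := posnP a; first by exists [::]; rewrite andbF.
have Pex : exists k, 'C(k, t.+1) <= a by exists 0; rewrite bin0n.
have leC k : k <= 'C(k + t, t.+1).
  by elim: k => // k IHk; rewrite addSn binS; have := bin_gt0 (k + t) t; lia.
have Pub k : 'C(k, t.+1) <= a -> k <= a + t.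
  by move=> ?; have := leC (k - t); have [|] := leqP t k; last lia;
    move=> ?; rewrite subnK //; lia.
case: (ex_maxnP Pex Pub) => k lea kmax.
have lta : a < 'C(k.+1, t.+1).
  by rewrite ltnNge; apply/negP => /kmax; rewrite ltnn.
have tk : t < k by apply: kmax; rewrite binn.
have [b0|b_gt0] := posnP (a - 'C(k, t.+1)).
  by exists [:: k]; rewrite is_binexp1 tk /=; apply/eqP; lia.
rewrite binS in lta.
have t_gt0 : 0 < t by case: t lta {IH Pex Pub leC kmax tk} lea b_gt0 => //; rewrite bin0; lia.
have [[|k' l]] := IH (a - 'C(k, t.+1)); rewrite t_gt0 b_gt0 /=.
  by rewrite /is_binexp.
move=> h; exists [:: k, k' & l]; rewrite is_binexp_cons lea h andbT /=.
have [_ _ le' _] := is_binexp_bounds h; rewrite ltnNge andbT.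
by apply/negP => /(leq_bin2l t); lia.
Qed.

Lemma is_binexp_unique t a ks ks' :
  is_binexp t a ks -> is_binexp t a ks' -> ks = ks'.
Proof.
elim: ks t a ks' => [|k l IH] t a [|k' l'] //.
case: t => [|t] h h'; first by case/and4P: h => /andP[].
have [_ _ lo hi] := is_binexp_bounds h.
have [_ _ lo' hi'] := is_binexp_bounds h'.
have ek : k = k'.
  apply/eqP; rewrite eqn_leq; apply/andP; split; rewrite leqNgt; apply/negP.
    by move=> /(leq_bin2l t.+1); lia.
  by move=> /(leq_bin2l t.+1); lia.
case: _ / ek h' {lo hi lo' hi'} => h'; congr cons.
case: l IH h => [|m l] IH h; case: l' h' => [|m' l'] h' //.
- move: h h'; rewrite is_binexp1 is_binexp_cons => /andP[_ /eqP->] /and3P[_ _].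
  by rewrite subnn => /is_binexp_bounds[]; lia.
- move: h h'; rewrite is_binexp1 is_binexp_cons => /and3P[_ _ h] /andP[_ /eqP e].
  by move: h; rewrite e subnn => /is_binexp_bounds[]; lia.
move: h h'; rewrite !is_binexp_cons => /and3P[_ _ h] /and3P[_ _ h'].
exact: IH h h'.
Qed.

Definition binexp (t a : nat) : seq nat := xchoose (ex_binexp t a).

Lemma binexpP t a ks : 0 < t -> 0 < a -> is_binexp t a ks <-> ks = binexp t a.
Proof.
move=> t0 a0; have : is_binexp t a (binexp t a).
  by move/implyP: (xchooseP (ex_binexp t a)); apply; rewrite t0.
move=> h.
by split=> [/is_binexp_unique|->] //; apply.
Qed.

(* a^<t>, meaningful for t >= 1 *)
Definition pseudo_power (a t : nat) : nat :=
  if a == 0 then 0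
  else \sum_(i < size (binexp t a)) 'C((nth 0 (binexp t a) i).+1, (t - i).+1).

Definition O_sequence (h : nat -> nat) : Prop :=
  h 0 = 1 /\ forall t, 1 <= t -> h t.+1 <= pseudo_power (h t) t.

Definition is_socle_degree (h : nat -> nat) (s : nat) : Prop :=
  h s <> 0 /\ forall t, s < t -> h t = 0.

(* The finite O-sequences of multiplicity d with last non-zero value >= 2,
   each seen as an infinite sequence that vanishes beyond its socle degree. *)
Definition A_set (d : nat) : set (nat -> nat) :=
  [set h | O_sequence h /\
    exists s, [/\ is_socle_degree h s, \sum_(t < s.+1) h t = d & 2 <= h s]].

(* fset_set sends infinite sets to the empty set, but A_set d is always
   finite: see A_set_finite. *)
Definition A (d : nat) : nat := #|` fset_set (A_set d)|.

Lemma A_set_bound d h : A_set d h ->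
  (forall t, h t <= d) /\ (forall t, d <= t -> h t = 0).
Proof.
move=> [[h0 hO] [s [[hs hgt] hd _]]].
have h_gt0 t : t <= s -> 0 < h t.
  move=> ts; rewrite lt0n; apply/eqP => ht.
  suff hz n : h (t + n) = 0 by apply: hs; rewrite -(subnKC ts) hz.
  elim: n => [|n IH]; first by rewrite addn0.
  have [tn0|tn0] := posnP (t + n); first by move: IH; rewrite tn0 h0.
  by apply/eqP; rewrite addnS -leqn0; have := hO _ tn0; rewrite IH.
have sd : s < d.
  have <- : \sum_(t < s.+1) 1 = s.+1 by rewrite sum_nat_const card_ord muln1.
  rewrite -hd; apply: leq_sum => i _.
  by apply: h_gt0; rewrite -ltnS.
split=> t; last by move=> dt; apply: hgt; apply: leq_trans dt.
have [ts|st] := leqP t s; last by rewrite hgt.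
by rewrite -hd (bigD1 (inord t)) //= inordK // leq_addr.
Qed.

Lemma A_set_finite d : finite_set (A_set d).
Proof.
pose f (g : {ffun 'I_d -> 'I_d.+1}) (t : nat) : nat :=
  if insub t is Some i then val (g i) else 0.
apply: (@sub_finite_set _ _ (f @` setT)); last first.
  by apply: finite_image; exact: finite_finset.
move=> h /A_set_bound[hd hz]; exists [ffun i : 'I_d => inord (h i)] => //.
apply/funext => t; rewrite /f; case: insubP => [i _ <-|].
  by rewrite ffunE /= inordK // ltnS.
by rewrite -leqNgt => /hz.
Qed.

Lemma A_set_card d : (A_set d #= `I_(A d))%card.
Proof. by have [n e] := (finite_setP _).1 (@A_set_finite d); rewrite /A (card_fset_set e). Qed.

(* A sequence (x_k)_{k >= 1}: the value x 0 is irrelevant. *)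
Definition sub_Fibonacci (x : nat -> nat) : Prop :=
  [/\ forall k, 1 <= k -> x k <= x k.+1,
      x 1 = 1, x 2 = 1 &
      forall k, 3 <= k -> x k <= x (k - 1) + x (k - 2)].

(* Main.v *)
(** Raising [h_1] by one is an injection from the sequences counted by [A d]
    to those counted by [A d.+1], since only the bound on [h_2] depends on
    [h_1] and it is non-decreasing in [h_1].  For [A d <= A d.-1 + A d.-2], a
    sequence whose last value is at least 3 loses one unit of that value, and a
    sequence whose last value is 2 loses it altogether.  In the second case the
    new last value is again at least 2, because an O-sequence with a value at
    most 1 in a positive degree stays at most 1 from then on. *)

Require Import Defs.
From mathcomp Require Import all_boot.
From mathcomp Require Import finmap zify.
From mathcomp Require Import boolp classical_sets cardinality.

Set Implicit Arguments.
Unset Strict Implicit.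
Unset Printing Implicit Defensive.

Local Open Scope nat_scope.

Lemma pseudo_powerE t a ks : 0 < t -> 0 < a -> is_binexp t a ks ->
  pseudo_power a t = \sum_(i < size ks) 'C((nth 0 ks i).+1, (t - i).+1).
Proof.
move=> t0 a0 /(binexpP _ t0 a0)->.
by rewrite /pseudo_power -if_neg -lt0n a0.
Qed.

(** The 1-binomial expansion of [a > 0] is the single term ['C(a, 1)]. *)
Lemma pseudo_power_t1 a : pseudo_power a 1 = 'C(a.+1, 2).
Proof.
have [->|a0] := posnP a; first by rewrite /pseudo_power eqxx.
rewrite (@pseudo_powerE 1 a [:: a]) //= ?big_ord1 //=.
by rewrite is_binexp1 a0 bin1 eqxx.
Qed.

(** The [t]-binomial expansion of 1 is ['C(t, t)], and raising both entries gives 1 again. *)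
Lemma pseudo_power_le1 a t : 0 < t -> a <= 1 -> pseudo_power a t <= 1.
Proof.
case: t => // t _; case: a => [|[|//]] _; first by rewrite /pseudo_power eqxx.
rewrite (@pseudo_powerE t.+1 1 [:: t.+1]) //= ?big_ord1 /= ?subn0 ?binn //.
by rewrite is_binexp1 leqnn binn eqxx.
Qed.

Lemma O_sequence_le1 h t u : O_sequence h -> 0 < t <= u -> h t <= 1 -> h u <= 1.
Proof.
move=> [_ hO] /andP[t0 /subnKC<-] ht; elim: (u - t) => [|n IH].
  by rewrite addn0.
rewrite addnS; apply: leq_trans (hO _ _) _; first lia.
by apply: pseudo_power_le1 IH; lia.
Qed.

Lemma socle_degree_unique h s s' :
  is_socle_degree h s -> is_socle_degree h s' -> s = s'.
Proof.
by move=> [hs zs] [hs' zs']; case: (ltngtP s s') => // [/zs|/zs'].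
Qed.

(** As a function of [h] alone, with junk value 0 if there is no socle degree, it lets the inverse
    maps in [A_le_add] locate the last value. *)
Definition socle_degree (h : nat -> nat) : nat :=
  xget 0 (fun s => is_socle_degree h s).

Lemma socle_degreeE h s : is_socle_degree h s -> socle_degree h = s.
Proof.
move=> hs; rewrite /socle_degree; case: xgetP => [s' _ hs'|/(_ s)//].
exact: socle_degree_unique hs' hs.
Qed.

Lemma A_set_intro d h s : O_sequence h -> is_socle_degree h s ->
  \sum_(t < s.+1) h t = d -> 2 <= h s -> A_set d h.
Proof. by move=> hO hs hd h2; split=> //; exists s. Qed.

Lemma A_set_socle_gt0 d h s : A_set d h -> is_socle_degree h s -> 0 < s.
Proof.
move=> [[h0 _] [s' [hs' _ h2]]] /socle_degree_unique/(_ hs') ->.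
by case: s' h2 {hs'}; rewrite ?h0.
Qed.

Lemma A_set_ge2 d h s t :
  A_set d h -> is_socle_degree h s -> 0 < t <= s -> 2 <= h t.
Proof.
move=> [hO [s' [hs' _ h2]]] /socle_degree_unique/(_ hs') -> ts.
by rewrite ltnNge; apply/negP => /(O_sequence_le1 hO ts); lia.
Qed.

Lemma sum_eq_nat n i : i < n -> \sum_(t < n) (t == i :> nat) = 1.
Proof.
move=> lin; rewrite (bigD1 (Ordinal lin)) //= eqxx big1 // => j.
by rewrite -val_eqE /= => /negPf->.
Qed.

Lemma A_set_raise1 d h : A_set d h -> A_set d.+1 (fun t => h t + (t == 1)).
Proof.
move=> hA; have [[h0 hO] [s [hs hd h2]]] := hA; have [_ zs] := hs.
have s0 := A_set_socle_gt0 hA hs.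
apply: (@A_set_intro _ _ s); last lia.
- split=> [|[|[|t]] // _]; rewrite ?h0 ?addn0 ?addn1 //; last exact: hO.
  (* Only the bound in degree 1 changes; there it is an explicit binomial, increasing in [h 1]. *)
  apply: leq_trans (hO 1 isT) _; rewrite !pseudo_power_t1.
  by apply: leq_bin2l; lia.
- by split=> [|t st]; [lia | rewrite zs //; lia].
by rewrite big_split /= hd sum_eq_nat // addn1.
Qed.

Lemma A_set_lower_last d h s : A_set d.+1 h -> is_socle_degree h s -> 2 < h s ->
  A_set d (fun t => h t - (t == s)) /\
  is_socle_degree (fun t => h t - (t == s)) s.
Proof.
move=> hA hs h3; have s0 := A_set_socle_gt0 hA hs; have [hs0 zs] := hs.
have hs' : is_socle_degree (fun t => h t - (t == s)) s.
  by split=> [|t st]; [rewrite eqxx; lia | rewrite zs].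
split=> //; case: hA => [[h0 hO] [s' [/(socle_degree_unique hs) <- hd _]]].
apply: (A_set_intro _ hs'); last by rewrite eqxx; lia.
- split=> [|t t0]; first by rewrite h0; case: (s) s0.
  (* Past [s] the next value is 0, so lowering [h s] costs nothing; in other degrees the bound is
     unchanged and the bounded value can only drop. *)
  have [->|ts] := eqVneq t s; first by rewrite zs.
  by rewrite subn0; apply: leq_trans (leq_subr _ _) (hO _ t0).
move: hd; rewrite !big_ord_recr /= eqxx.
under [in X in _ -> X]eq_bigr => i _ do rewrite (ltn_eqF (ltn_ord i)) subn0.
by lia.
Qed.

Lemma A_set_remove_last d h s : 2 < d -> A_set d.+2 h -> is_socle_degree h s ->
  h s = 2 ->
  A_set d (fun t => if t == s then 0 else h t) /\
  is_socle_degree (fun t => if t == s then 0 else h t) s.-1.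
Proof.
move=> d2 hA hs h2; have [hs0 zs] := hs.
have [[h0 hO] [s' [/(socle_degree_unique hs) <- hd _]]] := hA.
(* If [s = 1], the multiplicity would be 1 + 2 = 3, which [2 < d] excludes. Hence [s.-1] is a
   positive degree and [A_set_ge2] applies to it. *)
have s1 : 1 < s.
  case: s h2 hd {hs hs0 zs s'} => [|[|//]]; first by rewrite h0.
  by rewrite 2!big_ord_recr big_ord0 /= h0 => ->; lia.
have hp : 2 <= h s.-1 by apply: (A_set_ge2 hA hs); lia.
have ep : (s.-1 == s) = false by lia.
have hs' : is_socle_degree (fun t => if t == s then 0 else h t) s.-1.
  split=> [|t st]; first by rewrite ep; lia.
  by case: eqP => // ts; apply: zs; lia.
split=> //; apply: (A_set_intro _ hs'); last by rewrite ep.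
- split=> [|t t0]; first by rewrite h0; case: eqP s1 => // <-.
  case: (eqVneq t.+1 s) => // ts1.
  by have [->|_] := eqVneq t s; [rewrite zs | exact: hO].
move: hd; rewrite prednK 1?ltnW // big_ord_recr /= h2.
under [in X in _ -> X]eq_bigr => i _ do rewrite (ltn_eqF (ltn_ord i)).
by lia.
Qed.

Lemma mem_fset_A_set d h : (h \in fset_set (A_set d)) <-> A_set d h.
Proof.
rewrite in_fset_set; last exact: A_set_finite.
by rewrite in_setE.
Qed.

Lemma A_le_succ d : A d <= A d.+1.
Proof.
pose lower1 (h : nat -> nat) t := h t - (t == 1).
(* [lower1] undoes the raising of [h 1]; covering the smaller set by its image replaces a proof of
   injectivity. *)
have sub : (fset_set (A_set d) `<=` lower1 @` fset_set (A_set d.+1))%fset.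
  apply/fsubsetP => h /mem_fset_A_set hA; apply/imfsetP.
  exists (fun t => h t + (t == 1)); first exact/mem_fset_A_set/A_set_raise1.
  by apply/funext => t; rewrite /lower1 addnK.
by apply: leq_trans (fsubset_leq_card sub) _; exact: leq_imfset_card.
Qed.

Lemma A_le_add d : 2 < d -> A d.+2 <= A d.+1 + A d.
Proof.
move=> d2.
(* These two maps undo the lowering and the removal of the last value. Lowering keeps the socle
   degree and removal decreases it by one, so the altered position can be read off the new
   sequence. *)
pose raise_last (h : nat -> nat) t := h t + (t == socle_degree h).
pose append2 (h : nat -> nat) t :=
  if t == (socle_degree h).+1 then 2 else h t.
have sub : (fset_set (A_set d.+2) `<=` raise_last @` fset_set (A_set d.+1)
                                `|` append2 @` fset_set (A_set d))%fset.
  apply/fsubsetP => h /mem_fset_A_set hA.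
  have [_ [s [hs _ h2]]] := hA; have s0 := A_set_socle_gt0 hA hs.
  rewrite in_fsetU; apply/orP; have [h3|h3] := ltnP 2 (h s).
    have [hA' hs'] := A_set_lower_last hA hs h3; left; apply/imfsetP.
    exists (fun t => h t - (t == s)); first exact/mem_fset_A_set.
    apply/funext => t; rewrite /raise_last (socle_degreeE hs').
    by case: eqP => [->|_] /=; lia.
  have h2' : h s = 2 by lia.
  have [hA' hs'] := A_set_remove_last d2 hA hs h2'; right; apply/imfsetP.
  exists (fun t => if t == s then 0 else h t); first exact/mem_fset_A_set.
  apply/funext => t; rewrite /append2 (socle_degreeE hs') prednK //.
  by case: eqP => [->|].
apply: leq_trans (fsubset_leq_card sub) _.
rewrite cardfsU; apply: leq_trans (leq_subr _ _) _.
by apply: leq_add; exact: leq_imfset_card.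
Qed.

Lemma A_set_two_terms d : 2 < d -> A_set d (nth 0 [:: 1; d.-1]).
Proof.
move=> d2; apply: (@A_set_intro _ _ 1) => /=; last lia.
- by split=> // -[|[|[|t]]].
- by split=> [|[|[|[|t]]]] //=; lia.
by rewrite 2!big_ord_recr big_ord0 /=; lia.
Qed.

(** A socle degree of 2 or more needs multiplicity at least 1 + 2 + 2 = 5, so only [(1, d - 1)]
    remains. *)
Lemma A_eq1 d : 2 < d < 5 -> A d = 1.
Proof.
move=> /andP[d2 d5]; rewrite /A.
suff -> : A_set d = [set nth 0 [:: 1; d.-1]]%classic.
  by rewrite fset_set1 cardfs1.
apply/seteqP; split=> [h hA|h ->]; last exact: A_set_two_terms.
have [[h0 _] [s [hs hd h2]]] := hA; have [_ zs] := hs.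
have h1 : 2 <= h 1.
  by apply: (A_set_ge2 hA hs); rewrite (A_set_socle_gt0 hA hs).
case: s hs hd h2 zs => [|[|s]] hs hd h2 zs; first by rewrite h0 in h2.
  apply/funext => -[|[|t]] //=; last by rewrite zs // nth_nil.
  by move: hd; rewrite 2!big_ord_recr big_ord0 /= h0; lia.
by move: hd; rewrite big_ord_recr 2!big_ord_recl /= /bump /= addn0 h0; lia.
Qed.

Theorem proposition2p7 :
  (forall d : nat, 2 < d -> A d <= A d.+1) /\
  sub_Fibonacci (fun k : nat => A (k + 2)).
Proof.
split=> [d _|]; first exact: A_le_succ.
split=> [k _|||[|[|[|k]]] // _]; [|by rewrite A_eq1..|].
  by rewrite addSn A_le_succ.
(* The smallest index on the right is at least 3, as [A_le_add] requires. *)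
by rewrite subn1 subn2 /= !addSn; apply: A_le_add; lia.
Qed.
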